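(* Let $n\ge1$ and let $(\rho(F_n),\eta,L)$ be a Schürmann triple on $\mathrm{Pol}(S_n^+)$, where $\rho(F_n)$ is the representation associated to the Fourier matrix $F_n$. Put $\xi_j=\eta(p_{jj})$ for $j=1,\ldots,n$. Then the generating functional $L$ is symmetric (i.e. $L\circ S=L$) if and only if $$\langle\xi_i,P_m\xi_k\rangle=\langle P_{2-m}\xi_k,\xi_i\rangle\quad\text{for all } i,m,k=1,2,\ldots,n,$$ where indices of the projections $P$ are taken modulo $n$ in $\{1,\ldots,n\}$.
   Context: $\mathrm{Pol}(S_n^+)$ is the universal unital $*$-algebra generated by $p_{ij}$ ($1\le i,j\le n$) subject to $p_{ij}=p_{ij}^*=p_{ij}^2$, $p_{ij}p_{ik}=0=p_{ji}p_{ki}$ for $j\ne k$, and $\sum_j p_{ij}=\sum_j p_{ji}=1$ for all $i$. Its counit $\varepsilon$ is the character with $\varepsilon(p_{ij})=\delta_{ij}$; its antipode $S$ is the linear anti-multiplicative map with $S(p_{ij})=p_{ji}$. For $1\le j\le n$, $P_j$ is the orthogonal projection of $\mathbb{C}^n$ onto the line spanned by $h_j=(e^{2\pi i(k-1)(j-1)/n})_{k=1}^n$, the $j$-th row of the Fourier matrix $F_n$. The representation $\rho(F_n):\mathrm{Pol}(S_n^+)\to B(\mathbb{C}^n)$ is the unital $*$-homomorphism with $p_{jk}\mapsto P_{j-k+1}$ (index modulo $n$). A Schürmann triple $(\rho,\eta,L)$ consists of a unital $*$-homomorphism $\rho:\mathrm{Pol}(S_n^+)\to B(\mathsf{h})$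 ($\mathsf{h}$ a Hilbert space), a linear map $\eta:\mathrm{Pol}(S_n^+)\to\mathsf{h}$ with $\eta(ab)=\rho(a)\eta(b)+\eta(a)\varepsilon(b)$, and a hermitian functional $L$ with $L(a^*b)=\langle\eta(a),\eta(b)\rangle+\varepsilon(a^* )L(b)+L(a^* )\varepsilon(b)$ for all $a,b$ (inner product linear in the second argument). *)

(* Defs.v *)
From HB Require Import structures.
From mathcomp Require Import all_boot all_order all_algebra.
From mathcomp Require Import generic_quotient.
From mathcomp Require Import all_classical all_reals all_analysis.
From mathcomp Require Import complex.

Set Implicit Arguments.
Unset Strict Implicit.
Unset Printing Implicit Defensive.

Import Order.TTheory GRing.Theory Num.Theory.
Local Open Scope quotient_scope.
Local Open Scope ring_scope.

HB.mixin Record hasStar (C : numClosedFieldType) A of GRing.Algebra C A := {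
  star : A -> A;
  starK : involutive star;
  starD : {morph star : a b / a + b};
  starM : forall a b, star (a * b) = star b * star a;
  starZ : forall (c : C) a, star (c *: a) = c^* *: star a }.

#[short(type="starAlgType")]
HB.structure Definition StarAlgebra (C : numClosedFieldType) :=
  {A of GRing.Algebra C A & hasStar C A}.

Arguments star {C s} a : rename.

Section StarAlgTheory.
Context {C : numClosedFieldType} (A : starAlgType C).

Lemma star0 : star (0 : A) = 0.
Proof. by rewrite -(scale0r 0) starZ conjC0 !scale0r. Qed.

Lemma star1 : star (1 : A) = 1.
Proof. by rewrite -[LHS](mulr1 (star 1)) -{2}(starK (1 : A)) -starM mulr1 starK. Qed.

End StarAlgTheory.

Section ScalarStar.
Context {C : numClosedFieldType}.

Definition conj_reg (z : C^o) : C^o := z^*.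

Fact conj_regK : involutive conj_reg. Proof. exact: conjCK. Qed.
Fact conj_regD : {morph conj_reg : a b / a + b}.
Proof. by move=> a b; apply: rmorphD. Qed.
Fact conj_regM (a b : C^o) : conj_reg (a * b) = conj_reg b * conj_reg a.
Proof. by rewrite mulrC; apply: rmorphM. Qed.
Fact conj_regZ (c : C) (a : C^o) : conj_reg (c *: a) = c^* *: conj_reg a.
Proof. exact: rmorphM. Qed.

HB.instance Definition _ :=
  hasStar.Build C C^o conj_regK conj_regD conj_regM conj_regZ.

End ScalarStar.

Section MatrixStar.
Context {C : numClosedFieldType} {d : nat}.

Definition adjmx (A : 'M[C]_d.+1) : 'M[C]_d.+1 := map_mx Num.conj A^T.

Fact adjmxK : involutive adjmx.
Proof. by move=> A; apply/matrixP=> i j; rewrite !mxE conjCK. Qed.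
Fact adjmxD : {morph adjmx : A B / A + B}.
Proof. by move=> A B; apply/matrixP=> i j; rewrite !mxE rmorphD. Qed.
Fact adjmxM (A B : 'M[C]_d.+1) : adjmx (A * B) = adjmx B * adjmx A.
Proof. by rewrite /adjmx -!mulmxE trmx_mul map_mxM. Qed.
Fact adjmxZ (c : C) (A : 'M[C]_d.+1) : adjmx (c *: A) = c^* *: adjmx A.
Proof. by apply/matrixP=> i j; rewrite !mxE rmorphM. Qed.

HB.instance Definition _ :=
  hasStar.Build C 'M[C]_d.+1 adjmxK adjmxD adjmxM adjmxZ.

End MatrixStar.

(* The relations of Pol(S_n^+), for a family q in a *-algebra. *)
Definition magic_unitary {C : numClosedFieldType} {n : nat} {B : starAlgType C}
    (q : 'I_n -> 'I_n -> B) : Prop :=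
  [/\ forall i j, star (q i j) = q i j /\ q i j * q i j = q i j,
      forall i j k, j != k -> q i j * q i k = 0 /\ q j i * q k i = 0
    & forall i, \sum_j q i j = 1 /\ \sum_j q j i = 1].

(* The universal unital *-algebra is built as *-polynomial expressions in the
   generators modulo the least congruence [teq] containing the axioms of unital
   *-algebras and the defining relations; [pol_universal] below is the
   universal property. *)
Section Pol.
Context {C : numClosedFieldType} {n : nat}.

Inductive term :=
  | Gen of 'I_n & 'I_n
  | Cst of C
  | Add of term & term
  | Mul of term & term
  | Star of term.

Inductive teq : term -> term -> Prop :=
  | teq_refl t : teq t t
  | teq_sym s t : teq s t -> teq t s
  | teq_trans r s t : teq r s -> teq s t -> teq r t
  | teq_Add s s' t t' : teq s s' -> teq t t' -> teq (Add s t) (Add s' t')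
  | teq_Mul s s' t t' : teq s s' -> teq t t' -> teq (Mul s t) (Mul s' t')
  | teq_Star s t : teq s t -> teq (Star s) (Star t)
  | teq_addA r s t : teq (Add r (Add s t)) (Add (Add r s) t)
  | teq_addC s t : teq (Add s t) (Add t s)
  | teq_add0 t : teq (Add (Cst 0) t) t
  | teq_addN t : teq (Add (Mul (Cst (- 1)) t) t) (Cst 0)
  | teq_mulA r s t : teq (Mul r (Mul s t)) (Mul (Mul r s) t)
  | teq_mul1 t : teq (Mul (Cst 1) t) t
  | teq_mulDl r s t : teq (Mul (Add r s) t) (Add (Mul r t) (Mul s t))
  | teq_mulDr r s t : teq (Mul r (Add s t)) (Add (Mul r s) (Mul r t))
  | teq_cstD c d : teq (Cst (c + d)) (Add (Cst c) (Cst d))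
  | teq_cstM c d : teq (Cst (c * d)) (Mul (Cst c) (Cst d))
  | teq_cstC c t : teq (Mul (Cst c) t) (Mul t (Cst c))
  | teq_starK t : teq (Star (Star t)) t
  | teq_starD s t : teq (Star (Add s t)) (Add (Star s) (Star t))
  | teq_starM s t : teq (Star (Mul s t)) (Mul (Star t) (Star s))
  | teq_starC c : teq (Star (Cst c)) (Cst c^*)
  | teq_gen_star i j : teq (Star (Gen i j)) (Gen i j)
  | teq_gen_idem i j : teq (Mul (Gen i j) (Gen i j)) (Gen i j)
  | teq_gen_row i j k : j != k -> teq (Mul (Gen i j) (Gen i k)) (Cst 0)
  | teq_gen_col i j k : j != k -> teq (Mul (Gen j i) (Gen k i)) (Cst 0)
  | teq_sum_row i : teq (\big[Add/Cst 0]_j Gen i j) (Cst 1)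
  | teq_sum_col i : teq (\big[Add/Cst 0]_j Gen j i) (Cst 1).

HB.instance Definition _ := gen_eqMixin term.
HB.instance Definition _ := gen_choiceMixin term.

Definition teqb (s t : term) : bool := `[< teq s t >].

Fact teqb_equiv : equiv_class_of teqb.
Proof.
split.
- by move=> t; apply/asboolP/teq_refl.
- by move=> s t; apply/asboolP/asboolP => ?; apply: teq_sym.
- by move=> s r t /asboolP rs /asboolP st; apply/asboolP/(teq_trans rs st).
Qed.

Canonical teq_equiv := EquivRelPack teqb_equiv.

Definition pol : Type := {eq_quot teq_equiv}.
HB.instance Definition _ := Choice.on pol.
HB.instance Definition _ := Quotient.on pol.
HB.instance Definition _ := EqQuotient.on pol.

Lemma pol_eq (s t : term) : teq s t <-> \pi_pol s = \pi_pol t.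
Proof.
split=> [h|/eqmodP/asboolP//]; by apply/eqmodP/asboolP.
Qed.

Lemma repr_teq (t : term) : teq (repr (\pi_pol t)) t.
Proof. by apply/pol_eq; rewrite reprK. Qed.

Definition pol_gen (i j : 'I_n) : pol := \pi_pol (Gen i j).
Definition pol_cst (c : C) : pol := \pi_pol (Cst c).
Definition pol_add (a b : pol) : pol := \pi_pol (Add (repr a) (repr b)).
Definition pol_mul (a b : pol) : pol := \pi_pol (Mul (repr a) (repr b)).
Definition pol_star (a : pol) : pol := \pi_pol (Star (repr a)).
Definition pol_scale (c : C) (a : pol) : pol := pol_mul (pol_cst c) a.
Definition pol_opp (a : pol) : pol := pol_scale (- 1) a.

Lemma pi_Add s t : \pi_pol (Add s t) = pol_add (\pi_pol s) (\pi_pol t).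
Proof. by apply/pol_eq/teq_sym/teq_Add; apply: repr_teq. Qed.
Lemma pi_Mul s t : \pi_pol (Mul s t) = pol_mul (\pi_pol s) (\pi_pol t).
Proof. by apply/pol_eq/teq_sym/teq_Mul; apply: repr_teq. Qed.
Lemma pi_Star s : \pi_pol (Star s) = pol_star (\pi_pol s).
Proof. by apply/pol_eq/teq_sym/teq_Star; apply: repr_teq. Qed.

Fact pol_addA : associative pol_add.
Proof.
elim/quotW=> r; elim/quotW=> s; elim/quotW=> t; rewrite -(pi_Add s t) -(pi_Add r s) -(pi_Add r) -(pi_Add _ t).
by apply/pol_eq; exact: teq_addA.
Qed.
Fact pol_addC : commutative pol_add.
Proof. by elim/quotW=> s; elim/quotW=> t; rewrite -(pi_Add s t) -(pi_Add t s); apply/pol_eq; exact: teq_addC. Qed.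
Fact pol_add0 : left_id (pol_cst 0) pol_add.
Proof. by elim/quotW=> t; rewrite -(pi_Add _ t); apply/pol_eq; exact: teq_add0. Qed.
Fact pol_addN : left_inverse (pol_cst 0) pol_opp pol_add.
Proof. by elim/quotW=> t; rewrite /pol_opp /pol_scale -(pi_Mul _ t) -(pi_Add _ t); apply/pol_eq; exact: teq_addN. Qed.

HB.instance Definition _ :=
  GRing.isZmodule.Build pol pol_addA pol_addC pol_add0 pol_addN.

Fact pol_mulA : associative pol_mul.
Proof.
elim/quotW=> r; elim/quotW=> s; elim/quotW=> t; rewrite -(pi_Mul s t) -(pi_Mul r s) -(pi_Mul r) -(pi_Mul _ t).
by apply/pol_eq; exact: teq_mulA.
Qed.
Fact pol_mul1 : left_id (pol_cst 1) pol_mul.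
Proof. by elim/quotW=> t; rewrite -(pi_Mul _ t); apply/pol_eq; exact: teq_mul1. Qed.
Fact pol_cstC c a : pol_mul (pol_cst c) a = pol_mul a (pol_cst c).
Proof. by elim/quotW: a => t; rewrite -(pi_Mul _ t) -(pi_Mul t); apply/pol_eq; exact: teq_cstC. Qed.
Fact pol_mul1r : right_id (pol_cst 1) pol_mul.
Proof. by move=> a; rewrite -pol_cstC pol_mul1. Qed.
Fact pol_mulDl : left_distributive pol_mul +%R.
Proof.
elim/quotW=> r; elim/quotW=> s; elim/quotW=> t; rewrite /GRing.add/= -(pi_Add r s) -(pi_Mul _ t) -(pi_Mul r) -(pi_Mul s) -(pi_Add (Mul r t)).
by apply/pol_eq; exact: teq_mulDl.
Qed.
Fact pol_mulDr : right_distributive pol_mul +%R.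
Proof.
elim/quotW=> r; elim/quotW=> s; elim/quotW=> t; rewrite /GRing.add/= -(pi_Add s t) -(pi_Mul r) -(pi_Mul r s) -(pi_Mul r t) -(pi_Add (Mul r s)).
by apply/pol_eq; exact: teq_mulDr.
Qed.

Section Eval.
Context {B : starAlgType C} (q : 'I_n -> 'I_n -> B).

Fixpoint teval (t : term) : B :=
  match t with
  | Gen i j => q i j
  | Cst c => c%:A
  | Add s t => teval s + teval t
  | Mul s t => teval s * teval t
  | Star t => star (teval t)
  end.

Lemma teval_sum (f : 'I_n -> term) :
  teval (\big[Add/Cst 0]_j f j) = \sum_j teval (f j).
Proof. by apply: (big_morph teval) => //=; rewrite scale0r. Qed.

Lemma teval_teq s t : magic_unitary q -> teq s t -> teval s = teval t.
Proof.
move=> [q1 q2 q3]; elim=> /=.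
- by [].
- by [].
- by move=> ? ? ? _ -> _ ->.
- by move=> ? ? ? ? _ -> _ ->.
- by move=> ? ? ? ? _ -> _ ->.
- by move=> ? ? _ ->.
- by move=> *; rewrite addrA.
- by move=> *; rewrite addrC.
- by move=> *; rewrite scale0r add0r.
- by move=> *; rewrite scaleN1r mulN1r addNr scale0r.
- by move=> *; rewrite mulrA.
- by move=> *; rewrite scale1r mul1r.
- by move=> *; rewrite mulrDl.
- by move=> *; rewrite mulrDr.
- by move=> *; rewrite scalerDl.
- by move=> *; rewrite -scalerAl mul1r scalerA.
- by move=> *; rewrite -scalerAl -scalerAr mul1r mulr1.
- by move=> *; rewrite starK.
- by move=> *; rewrite starD.
- by move=> *; rewrite starM.
- by move=> *; rewrite starZ star1.
- by move=> i j; case: (q1 i j).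
- by move=> i j; case: (q1 i j).
- by move=> i j k /(q2 i)[]; rewrite scale0r.
- by move=> i j k /(q2 i)[]; rewrite scale0r.
- by move=> i; rewrite teval_sum scale1r; case: (q3 i).
- by move=> i; rewrite teval_sum scale1r; case: (q3 i).
Qed.

End Eval.

Definition delta_gen (i j : 'I_n) : C^o := (i == j)%:R.

Fact delta_magic : magic_unitary delta_gen.
Proof.
rewrite /delta_gen; split.
- move=> i j; split; first exact: conjC_nat.
  by rewrite -natrM mulnb andbb.
- move=> i j k jk; split; rewrite -natrM mulnb.
    by case: eqP => //= ->; rewrite (negPf jk).
  by case: (eqVneq j i) => //= <-; rewrite eq_sym (negPf jk).
- move=> i; split; rewrite (bigD1 i)//= eqxx big1 ?addr0// => j ji.
    by rewrite eq_sym (negPf ji).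
  by rewrite (negPf ji).
Qed.

Fact pol_1_neq0 : pol_cst 1 != 0.
Proof.
apply/eqP => /pol_eq /(teval_teq delta_magic) /=.
by rewrite scale0r scale1r => /eqP; rewrite oner_eq0.
Qed.

HB.instance Definition _ := GRing.Zmodule_isNzRing.Build pol
  pol_mulA pol_mul1 pol_mul1r pol_mulDl pol_mulDr pol_1_neq0.

Fact pol_cstD c d : pol_cst (c + d) = pol_cst c + pol_cst d.
Proof. by rewrite /GRing.add/= /pol_cst -(pi_Add (Cst c)); apply/pol_eq; exact: teq_cstD. Qed.
Fact pol_cstM c d : pol_cst (c * d) = pol_cst c * pol_cst d.
Proof. by rewrite [RHS]/GRing.mul/= /pol_cst -(pi_Mul (Cst c)); apply/pol_eq; exact: teq_cstM. Qed.

Fact pol_scaleA c d a : pol_scale c (pol_scale d a) = pol_scale (c * d) a.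
Proof. by rewrite /pol_scale pol_cstM pol_mulA. Qed.
Fact pol_scale1 : left_id 1 pol_scale.
Proof. exact: pol_mul1. Qed.
Fact pol_scaleDr : right_distributive pol_scale +%R.
Proof. by move=> c a b; apply: pol_mulDr. Qed.
Fact pol_scaleDl a : {morph pol_scale^~ a : c d / c + d}.
Proof. by move=> c d; rewrite /pol_scale pol_cstD pol_mulDl. Qed.

HB.instance Definition _ := GRing.Zmodule_isLmodule.Build C pol
  pol_scaleA pol_scale1 pol_scaleDr pol_scaleDl.

Fact pol_scaleAl (c : C) (a b : pol) : c *: (a * b) = (c *: a) * b.
Proof. exact: pol_mulA. Qed.

HB.instance Definition _ := GRing.Lmodule_isLalgebra.Build C pol pol_scaleAl.

Fact pol_scaleAr (c : C) (a b : pol) : c *: (a * b) = a * (c *: b).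
Proof.
rewrite /GRing.scale/= /pol_scale /GRing.mul/=.
by rewrite pol_mulA pol_cstC -pol_mulA.
Qed.

HB.instance Definition _ := GRing.Lalgebra_isAlgebra.Build C pol pol_scaleAr.

Fact pol_starK : involutive pol_star.
Proof. by elim/quotW=> t; rewrite -(pi_Star t) -(pi_Star (Star t)); apply/pol_eq; exact: teq_starK. Qed.
Fact pol_starD : {morph pol_star : a b / a + b}.
Proof.
elim/quotW=> s; elim/quotW=> t; rewrite /GRing.add/= -(pi_Add s t) -(pi_Star (Add s t)) -(pi_Star s) -(pi_Star t) -(pi_Add (Star s)).
by apply/pol_eq; exact: teq_starD.
Qed.
Fact pol_starM a b : pol_star (a * b) = pol_star b * pol_star a.
Proof.
elim/quotW: a => s; elim/quotW: b => t; rewrite /GRing.mul/= -(pi_Mul s t) -(pi_Star (Mul s t)) -(pi_Star s) -(pi_Star t) -(pi_Mul (Star t)).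
by apply/pol_eq; exact: teq_starM.
Qed.
Fact pol_starZ (c : C) a : pol_star (c *: a) = c^* *: pol_star a.
Proof.
rewrite /GRing.scale/= /pol_scale; elim/quotW: a => t.
rewrite pol_cstC /pol_cst -(pi_Mul t) -(pi_Star (Mul t _)) -(pi_Star t) -(pi_Mul (Cst _)); apply/pol_eq.
by apply: (teq_trans (teq_starM _ _)); apply: teq_Mul (teq_refl _); apply: teq_starC.
Qed.

HB.instance Definition _ :=
  hasStar.Build C pol pol_starK pol_starD pol_starM pol_starZ.

Lemma pi_AddE s t : \pi_pol (Add s t) = \pi_pol s + \pi_pol t.
Proof. exact: pi_Add. Qed.
Lemma pi_MulE s t : \pi_pol (Mul s t) = \pi_pol s * \pi_pol t.
Proof. exact: pi_Mul. Qed.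
Lemma pi_StarE s : \pi_pol (Star s) = star (\pi_pol s).
Proof. exact: pi_Star. Qed.
Lemma pi_CstE c : \pi_pol (Cst c) = c%:A.
Proof. by rewrite /GRing.scale/= /pol_scale pol_mul1r. Qed.

Lemma pol_gen_magic : magic_unitary pol_gen.
Proof.
have sumE (f : 'I_n -> term) :
    \sum_j \pi_pol (f j) = \pi_pol (\big[Add/Cst 0]_j f j).
  by rewrite (big_morph _ pi_AddE (_ : \pi_pol (Cst 0) = 0))//.
split.
- by move=> i j; split; rewrite /pol_gen -?pi_StarE -?pi_MulE; apply/pol_eq;
    constructor.
- by move=> i j k jk; split; rewrite /pol_gen -pi_MulE; apply/pol_eq;
    constructor.
- by move=> i; split; rewrite sumE; apply/pol_eq; constructor.
Qed.

Lemma pol_ind (P : pol -> Prop) :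
  (forall i j, P (pol_gen i j)) -> (forall c : C, P c%:A) ->
  (forall a b, P a -> P b -> P (a + b)) ->
  (forall a b, P a -> P b -> P (a * b)) ->
  forall a, P a.
Proof.
move=> Pg Pc PD PM.
suff PP t : P (\pi_pol t) /\ P (star (\pi_pol t)) by elim/quotW=> t; case: (PP t).
elim: t => [i j|c|s [s1 s2] t [t1 t2]|s [s1 s2] t [t1 t2]|t [t1 t2]].
- by rewrite -/(pol_gen i j); have [/(_ i j)[-> _]] := pol_gen_magic.
- by rewrite pi_CstE starZ star1.
- by rewrite pi_AddE starD; split; apply: PD.
- by rewrite pi_MulE starM; split; apply: PM.
- by rewrite pi_StarE starK.
Qed.

Section Lift.
Context {B : starAlgType C} (q : 'I_n -> 'I_n -> B) (hq : magic_unitary q).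

Definition pol_lift of magic_unitary q := fun a : pol => teval q (repr a).

Lemma pol_lift_pi t : pol_lift hq (\pi_pol t) = teval q t.
Proof. exact/(teval_teq hq)/repr_teq. Qed.

Fact pol_lift_linear : linear (pol_lift hq).
Proof.
move=> c; elim/quotW=> s; elim/quotW=> t.
rewrite -[c *: _]mulr_algl -pi_CstE -pi_MulE -pi_AddE !pol_lift_pi/=.
by rewrite mulr_algl.
Qed.
HB.instance Definition _ :=
  GRing.isLinear.Build C pol B *:%R (pol_lift hq) pol_lift_linear.

Fact pol_lift_monoid : monoid_morphism (pol_lift hq).
Proof.
split; first by rewrite -[1]scale1r -pi_CstE pol_lift_pi/= scale1r.
by elim/quotW=> s; elim/quotW=> t; rewrite -pi_MulE !pol_lift_pi.
Qed.
HB.instance Definition _ :=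
  GRing.isMonoidMorphism.Build pol B (pol_lift hq) pol_lift_monoid.

Lemma pol_lift_star a : pol_lift hq (star a) = star (pol_lift hq a).
Proof. by elim/quotW: a => t; rewrite -pi_StarE !pol_lift_pi. Qed.

Lemma pol_lift_gen i j : pol_lift hq (pol_gen i j) = q i j.
Proof. by rewrite pol_lift_pi. Qed.

Theorem pol_universal :
  exists! f : pol -> B,
    [/\ linear f, monoid_morphism f, forall a, f (star a) = star (f a)
      & forall i j, f (pol_gen i j) = q i j].
Proof.
exists (pol_lift hq); split.
  split; [exact: pol_lift_linear|exact: pol_lift_monoid|exact: pol_lift_star|].
  exact: pol_lift_gen.
move=> g [gl [g1 gM] _ gg]; apply/funext; elim/pol_ind => [i j|c|a b ga gb|a b ga gb].
- by rewrite pol_lift_gen gg.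
- by rewrite (scalable_linear gl) g1 linearZ rmorph1.
- by rewrite raddfD /= ga gb -[a in RHS]scale1r gl scale1r.
- by rewrite rmorphM /= gM ga gb.
Qed.

End Lift.

Definition counit : {lrmorphism pol -> C^o} := pol_lift delta_magic.

Lemma counit_gen i j : counit (pol_gen i j) = (i == j)%:R.
Proof. exact: pol_lift_gen. Qed.

Lemma counit_star a : counit (star a) = (counit a : C)^*.
Proof. exact: pol_lift_star. Qed.

Fixpoint tantipode (t : term) : term :=
  match t with
  | Gen i j => Gen j i
  | Cst c => Cst c
  | Add s t => Add (tantipode s) (tantipode t)
  | Mul s t => Mul (tantipode t) (tantipode s)
  | Star t => Star (tantipode t)
  end.

Lemma tantipode_teq s t : teq s t -> teq (tantipode s) (tantipode t).
Proof.
have tsum (f : 'I_n -> term) :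
    tantipode (\big[Add/Cst 0]_j f j) = \big[Add/Cst 0]_j tantipode (f j).
  exact: (big_morph tantipode).
elim=> /=; try by constructor.
- by move=> r {}s {}t _ rs _ st; apply: teq_trans rs st.
- by move=> u; apply: (teq_trans _ (teq_addN _)); apply: teq_Add (teq_refl _);
    apply/teq_sym/teq_cstC.
- by move=> *; apply/teq_sym/teq_mulA.
- by move=> u; apply: (teq_trans _ (teq_mul1 _)); apply/teq_sym/teq_cstC.
- by move=> c d; rewrite mulrC; apply: teq_cstM.
- by move=> c u; apply/teq_sym/teq_cstC.
- by move=> i j k jk; apply: teq_gen_col; rewrite eq_sym.
- by move=> i j k jk; apply: teq_gen_row; rewrite eq_sym.
- by move=> i; rewrite tsum; apply: teq_sum_col.
- by move=> i; rewrite tsum; apply: teq_sum_row.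
Qed.

Definition antipode (a : pol) : pol := \pi_pol (tantipode (repr a)).

Lemma antipode_pi t : antipode (\pi_pol t) = \pi_pol (tantipode t).
Proof. exact/pol_eq/tantipode_teq/repr_teq. Qed.

Fact antipode_linear : linear antipode.
Proof.
move=> c; elim/quotW=> s; elim/quotW=> t.
rewrite -[c *: _]mulr_algr -pi_CstE -pi_MulE -pi_AddE !antipode_pi/=.
by rewrite pi_AddE pi_MulE pi_CstE mulr_algl.
Qed.
HB.instance Definition _ :=
  GRing.isLinear.Build C pol pol *:%R antipode antipode_linear.

Lemma antipodeM a b : antipode (a * b) = antipode b * antipode a.
Proof.
elim/quotW: a => s; elim/quotW: b => t.
by rewrite -pi_MulE !antipode_pi -pi_MulE.
Qed.

Lemma antipode1 : antipode 1 = 1.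
Proof. by rewrite -[1]scale1r -pi_CstE antipode_pi. Qed.

Lemma antipode_gen i j : antipode (pol_gen i j) = pol_gen j i.
Proof. exact: antipode_pi. Qed.

End Pol.

Arguments pol C n : clear implicits.

(* The inner product of C^d is linear in the second argument. *)
Definition inner {C : numClosedFieldType} {d : nat} (u v : 'cV[C]_d) : C :=
  \sum_k (u k 0)^* * v k 0.

(* B(C^d) is the matrix algebra, acting on column vectors. *)
Record schurmann_triple {C : numClosedFieldType} {n d : nat}
    (rho : {lrmorphism pol C n -> 'M[C]_d.+1})
    (eta : {linear pol C n -> 'cV[C]_d.+1})
    (L : {scalar pol C n}) : Prop := SchurmannTriple {
  schurmann_star : forall a, rho (star a) = star (rho a);
  schurmann_cocycle : forall a b,
    eta (a * b) = rho a *m eta b + (counit b : C) *: eta a;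
  schurmann_hermitian : forall a, L (star a) = (L a)^*;
  schurmann_coboundary : forall a b,
    L (star a * b) = inner (eta a) (eta b)
                     + counit (star a) * L b + L (star a) * counit b }.

Definition symmetric_functional {C : numClosedFieldType} {n : nat}
    (L : pol C n -> C) : Prop :=
  forall a, L (antipode a) = L a.

Section LineProjection.
Context {C : numClosedFieldType} {d : nat}.
Implicit Types h u v : 'cV[C]_d.

(* The orthogonal projection onto the line spanned by h. *)
Definition line_proj h : 'M[C]_d :=
  (inner h h)^-1 *: (h *m map_mx Num.conj h^T).

Lemma line_projE h v : line_proj h *m v = (inner h v / inner h h) *: h.
Proof.
rewrite /line_proj -scalemxAl -mulmxA.
have -> : map_mx Num.conj h^T *m v = (inner h v)%:M.
  apply/matrixP => i j; rewrite !ord1 !mxE mulr1n.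
  by apply: eq_bigr => k _; rewrite !mxE.
by rewrite mul_mx_scalar scalerA mulrC.
Qed.


Lemma line_proj_star h : map_mx Num.conj (line_proj h)^T = line_proj h.
Proof.
have hh : (inner h h)^* = inner h h.
  by rewrite rmorph_sum; apply: eq_bigr => k _; rewrite rmorphM /= conjCK mulrC.
apply/matrixP => i j; rewrite !mxE !big_ord1 !mxE.
by rewrite !rmorphM /= fmorphV /= hh conjCK [X in _ * X]mulrC.
Qed.

Lemma line_projM h g :
  line_proj h *m line_proj g = (inner h g / inner h h / inner g g) *:
    (h *m map_mx Num.conj g^T).
Proof.
rewrite {2}/line_proj -scalemxAr mulmxA line_projE -scalemxAl scalerA.
by rewrite mulrC.
Qed.

End LineProjection.

Section Fourier.
Context {R : realType}.

(* cis t = exp (i t) *)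
Definition cis (t : R) : R[i] := Complex (cos t) (sin t).

Lemma cisD s t : cis (s + t) = cis s * cis t.
Proof.
rewrite /cis cosD sinD; apply/eqP; rewrite eq_complex /= eqxx/=.
by rewrite addrC.
Qed.

Lemma cisN t : (cis t)^* = cis (- t).
Proof. by rewrite /cis cosN sinN. Qed.

Lemma cis0 : cis 0 = 1.
Proof. by rewrite /cis cos0 sin0. Qed.

Lemma cisX t k : cis (t *+ k) = cis t ^+ k.
Proof.
by elim: k => [|k IH]; rewrite ?mulr0n ?cis0// mulrS cisD IH exprS.
Qed.

Lemma cis_pos_neq1 t : 0 < t < pi *+ 2 -> cis t != 1.
Proof.
move=> /andP[t0 t2]; rewrite /cis eq_complex /= negb_and; apply/orP; left.
have st : 0 < sin (t / 2).
  apply: sin_gt0_pi; rewrite divr_gt0//= ltr_pdivrMr//.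
  by rewrite mulr_natr.
have -> : t = (t / 2) *+ 2 by rewrite -mulr_natr mulfVK.
rewrite cos_mulr2n; apply/eqP => /eqP.
rewrite subr_eq -mulr2n -[X in _ == X *+ _](cos2Dsin2 (t / 2)) mulrnDl.
rewrite -subr_eq0 opprD addNKr oppr_eq0 mulrn_eq0/= sqrf_eq0.
by rewrite (gt_eqF st).
Qed.

Lemma cis2pi : cis (pi *+ 2) = 1.
Proof. by rewrite /cis cos2pi -[pi *+ 2]add0r sinD2pi sin0. Qed.

Context {n : nat}.
Implicit Types i j k l m : 'I_n.+1.

Local Notation theta := (pi *+ 2 / n.+1%:R : R).

Lemma sum_cis i j :
  \sum_(k < n.+1) cis (theta * (i%:R - j%:R) *+ k) = (i == j)%:R * n.+1%:R.
Proof.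
have N0 : (n.+1%:R : R) != 0 by rewrite pnatr_eq0.
have [->|ij] := eqVneq i j.
  under eq_bigr do rewrite subrr mulr0 mul0rn cis0.
  by rewrite sumr_const card_ord mul1r.
rewrite mul0r; under eq_bigr do rewrite cisX.
set z := cis _.
have th0 : 0 < theta by rewrite divr_gt0// pmulrn_lgt0// pi_gt0.
have key a b : (b < a)%N -> (a < n.+1)%N ->
    cis (theta * (a%:R - b%:R)) != 1.
  move=> ba an; apply: cis_pos_neq1; rewrite mulr_gt0 ?subr_gt0 ?ltr_nat//=.
  rewrite -[ltRHS](divfK N0) ltr_pM2l// -natrB ?(ltnW ba)// ltr_nat.
  by rewrite (leq_ltn_trans (leq_subr _ _)).
have z1 : z != 1.
  case: (ltngtP i j) => [lt|lt|/val_inj eq]; last by rewrite eq eqxx in ij.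
    apply/eqP => zE; have /eqP := key _ _ lt (ltn_ord j); apply.
    by rewrite -opprB mulrN -cisN -/z zE rmorph1.
  exact: key.
have zN : z ^+ n.+1 = 1.
  rewrite /z -cisX -[_ *+ n.+1]mulr_natr mulrAC divfK// mulrBr cisD -cisN.
  by rewrite !mulr_natr !(cisX (pi *+ 2)) cis2pi !expr1n mul1r rmorph1.
apply/eqP; have /eqP := subrX1 z n.+1.
by rewrite zN subrr eq_sym mulf_eq0 subr_eq0 (negPf z1).
Qed.

(* Indices start at 0 and live in the additive group 'I_n.+1 of integers modulo
   n.+1: [fourier_vec j] is h_(j+1) and [fourier_proj j] is P_(j+1). *)
Definition fourier_vec j : 'cV[R[i]]_n.+1 :=
  \col_k cis (2 * pi * k%:R * j%:R / n.+1%:R).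

Definition fourier_proj j : 'M[R[i]]_n.+1 := line_proj (fourier_vec j).

Lemma fourier_vecE j k : fourier_vec j k 0 = cis (theta * j%:R *+ k).
Proof.
rewrite mxE; congr cis; rewrite -[pi *+ 2]mulr_natl -[RHS]mulr_natr.
by rewrite [LHS]mulrAC [in LHS](mulrAC (2 * pi)) [RHS]mulrAC.
Qed.

Lemma fourier_vecC j k : fourier_vec j k 0 = fourier_vec k j 0.
Proof. by rewrite !mxE [in RHS](mulrAC (2 * pi)). Qed.

Lemma fourier_inner i j :
  inner (fourier_vec i) (fourier_vec j) = (i == j)%:R * n.+1%:R.
Proof.
rewrite eq_sym -sum_cis; apply: eq_bigr => k _.
by rewrite !fourier_vecE cisN -cisD addrC mulrBr mulrnBl.
Qed.

Lemma fourier_projM i j :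
  fourier_proj i * fourier_proj j = (i == j)%:R *: fourier_proj j.
Proof.
rewrite [LHS]line_projM !fourier_inner !eqxx !mul1r /fourier_proj /line_proj.
rewrite fourier_inner eqxx mul1r scalerA mulfK ?pnatr_eq0//.
by have [->|_] := eqVneq i j; rewrite ?mul0r ?scale0r.
Qed.

Lemma fourier_proj_sum : \sum_j fourier_proj j = 1.
Proof.
apply/matrixP => k l; rewrite summxE !mxE.
have N0 : (n.+1%:R : R[i]) != 0 by rewrite pnatr_eq0.
transitivity ((n.+1%:R : R[i])^-1 * ((k == l)%:R * n.+1%:R)); last first.
  by rewrite mulrC mulfK.
rewrite -sum_cis mulr_sumr; apply: eq_bigr => j _.
rewrite /fourier_proj /line_proj fourier_inner eqxx mul1r.
rewrite !(mxE mulmx_key, mxE scalemx_key) big_ord1 !(mxE map_mx_key, mxE trmx_key).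
by rewrite !(fourier_vecC j) !fourier_vecE cisN -cisD mulrBr mulrnBl.
Qed.

Definition fourier_gen j k : 'M[R[i]]_n.+1 := fourier_proj (j - k).

Fact fourier_magic : magic_unitary fourier_gen.
Proof.
rewrite /fourier_gen; split.
- by move=> i j; split; [exact: line_proj_star|rewrite fourier_projM eqxx scale1r].
- move=> i j k jk; split; rewrite fourier_projM.
    by rewrite (inj_eq (addrI _)) eqr_opp (negPf jk) scale0r.
  by rewrite (inj_eq (addIr _)) (negPf jk) scale0r.
- move=> i; rewrite -fourier_proj_sum; split; apply/esym.
    by apply: reindex_inj => a b /addrI/oppr_inj.
  by apply: reindex_inj => a b /addIr.
Qed.

Definition fourier_rep : {lrmorphism pol R[i] n.+1 -> 'M[R[i]]_n.+1} :=
  pol_lift fourier_magic.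

Lemma fourier_rep_gen j k : fourier_rep (pol_gen j k) = fourier_proj (j - k).
Proof. exact: pol_lift_gen. Qed.

Lemma fourier_rep_star a : fourier_rep (star a) = star (fourier_rep a).
Proof. exact: pol_lift_star. Qed.

End Fourier.

Arguments fourier_rep R n : clear implicits.

(* Main.v *)
Require Import Defs.
From mathcomp Require Import all_boot all_order all_algebra.
From mathcomp Require Import reals complex.
Import GRing.Theory Num.Theory.
Local Open Scope ring_scope.

(** Write [P_m] for the projections of the representation, [xi_j] for
    [eta (p_jj)], and [a'] for the image of [a] under the antilinear
    automorphism [star \o antipode], which sends [p_jk] to [p_kj]. Since
    [counit \o antipode = counit], expanding [L (a b)] and
    [L (antipode (a b)) = L (antipode b * antipode a)] by the coboundary identity
    shows that the symmetry of [L] amounts to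
      [<eta a, eta b> = <eta b', eta a'>]    for all [a] and [b],
    together with the symmetry of [L] on the generators, which is a special case
    because [L (p_jk) = <eta p_jk, eta p_jk>] when [j <> k].

    If [L] is symmetric, the cases [b = p_m0 * p_kk] and [b = p_m0] of this
    identity, with [a = p_ii], differ by the required relation, because
    [eta (p_m0 * p_kk) = P_m xi_k + eta p_m0] and
    [eta (p_0m * p_kk) = P_(- m) xi_k + eta p_0m].

    Conversely the relations of the magic unitary give
    [eta p_jk = - P_(j - k) xi_k] for [j <> k], whether one reads them along rows
    or along columns. So [eta b] is obtained from the [xi_j] by linear
    combinations and applications of the [P_m], and [eta b'] by the same
    operations with conjugated coefficients and [P_(- m)] in place of [P_m]
    ([twisted_closed_cocycle]). The identity above is sesquilinear and compatible
    with these operations, so it propagates from the [xi_j] to both arguments;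
    this is done one argument at a time by an annihilator and a double
    annihilator ([twisted_annihilator], [twisted_biannihilator]). *)

(** * The inner product *)

Section Inner.
Context {C : numClosedFieldType} {d : nat}.
Implicit Types u v w : 'cV[C]_d.+1.

Lemma innerDl u v w : inner (u + v) w = inner u w + inner v w.
Proof.
by rewrite -big_split; apply: eq_bigr => k _; rewrite mxE rmorphD mulrDl.
Qed.

Lemma innerDr u v w : inner u (v + w) = inner u v + inner u w.
Proof. by rewrite -big_split; apply: eq_bigr => k _; rewrite mxE mulrDr. Qed.

Lemma innerZl c u v : inner (c *: u) v = c^* * inner u v.
Proof.
by rewrite mulr_sumr; apply: eq_bigr => k _; rewrite mxE rmorphM mulrA.
Qed.

Lemma innerZr c u v : inner u (c *: v) = c * inner u v.
Proof. by rewrite mulr_sumr; apply: eq_bigr => k _; rewrite mxE mulrCA. Qed.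

Lemma inner0l v : inner 0 v = 0.
Proof. by rewrite -(scale0r 0) innerZl conjC0 mul0r. Qed.

Lemma inner0r u : inner u 0 = 0.
Proof. by rewrite -(scale0r 0) innerZr mul0r. Qed.

Lemma inner_suml (I : finType) (f : I -> 'cV[C]_d.+1) v :
  inner (\sum_i f i) v = \sum_i inner (f i) v.
Proof.
by apply: (big_morph (inner^~ v)) => [x y|]; rewrite ?innerDl ?inner0l.
Qed.

Lemma inner_sumr (I : finType) u (f : I -> 'cV[C]_d.+1) :
  inner u (\sum_i f i) = \sum_i inner u (f i).
Proof.
by apply: (big_morph (inner u)) => [x y|]; rewrite ?innerDr ?inner0r.
Qed.

Lemma inner_mulmxl (A : 'M[C]_d.+1) u v :
  inner (A *m u) v = inner u (star A *m v).
Proof.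
rewrite /inner.
under eq_bigr => k _ do rewrite mxE rmorph_sum mulr_suml.
rewrite exchange_big; apply: eq_bigr => l _.
rewrite mxE mulr_sumr; apply: eq_bigr => k _.
by rewrite !mxE rmorphM mulrAC mulrC.
Qed.

End Inner.

(** * The automorphism exchanging rows and columns *)

Section Twist.
Context {C : numClosedFieldType} {n : nat}.
Implicit Types a b : pol C n.

Lemma counit_antipode a : counit (antipode a) = counit a.
Proof.
elim/(@pol_ind C n): a => [i j|c|a b IHa IHb|a b IHa IHb].
- by rewrite antipode_gen !counit_gen eq_sym.
- by rewrite linearZ /= antipode1.
- by rewrite !raddfD /= IHa IHb.
- by rewrite antipodeM !rmorphM /= IHa IHb mulrC.
Qed.

Lemma antipode_star a : antipode (star a) = star (antipode a).
Proof.
have [gen_star _ _] := @pol_gen_magic C n.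
elim/(@pol_ind C n): a => [i j|c|a b IHa IHb|a b IHa IHb].
- by rewrite antipode_gen !(proj1 (gen_star _ _)) antipode_gen.
- by rewrite starZ star1 !linearZ /= antipode1 starZ star1.
- by rewrite !(starD, raddfD) /= IHa IHb.
- by rewrite starM !antipodeM starM IHa IHb.
Qed.

Definition twist a : pol C n := star (antipode a).

Lemma twistD a b : twist (a + b) = twist a + twist b.
Proof. by rewrite /twist raddfD starD. Qed.

Lemma twistM a b : twist (a * b) = twist a * twist b.
Proof. by rewrite /twist antipodeM starM. Qed.

Lemma twistZ c a : twist (c *: a) = c^* *: twist a.
Proof. by rewrite /twist linearZ starZ. Qed.

Lemma twist1 : twist 1 = 1.
Proof. by rewrite /twist antipode1 star1. Qed.

Lemma twist_gen j k : twist (pol_gen j k) = pol_gen k j.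
Proof.
by rewrite /twist antipode_gen; have [/(_ k j)[-> _] _ _] := @pol_gen_magic C n.
Qed.

Lemma twist_star a : twist (star a) = antipode a.
Proof. by rewrite /twist antipode_star starK. Qed.

Lemma counit_twist a : counit (twist a) = (counit a : C)^*.
Proof. by rewrite counit_star counit_antipode. Qed.

End Twist.

(** * Cocycles over a circulant representation *)

Section Circulant.
Context {C : numClosedFieldType} {n d : nat}.
Context {rho : {lrmorphism pol C n.+1 -> 'M[C]_d.+1}}.
Context {eta : {linear pol C n.+1 -> 'cV[C]_d.+1}} {L : {scalar pol C n.+1}}.
Context (triple : schurmann_triple rho eta L).
Context {P : 'I_n.+1 -> 'M[C]_d.+1}.
Context (rho_gen : forall j k, rho (pol_gen j k) = P (j - k)).

Local Notation p := (@pol_gen C n.+1).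
Local Notation xi j := (eta (p j j)).

Let etaM := schurmann_cocycle triple.

Let rho_first_col m : rho (p m 0) = P m.
Proof. by rewrite rho_gen subr0. Qed.

Let rho_first_row m : rho (p 0 m) = P (- m).
Proof. by rewrite rho_gen sub0r. Qed.

Lemma circulant_self_adjoint m : star (P m) = P m.
Proof.
rewrite -rho_first_col -(schurmann_star triple).
by have [/(_ m 0)[-> _] _ _] := @pol_gen_magic C n.+1.
Qed.

Lemma circulant_mul l m : P l *m P m = (l == m)%:R *: P m.
Proof.
have [gen1 gen2 _] := @pol_gen_magic C n.+1.
rewrite -!rho_first_col mulmxE -rmorphM; have [->|lm] := eqVneq l m.
  by rewrite scale1r; case: (gen1 m 0) => _ ->.
by case: (gen2 0 _ _ lm) => _ ->; rewrite scale0r raddf0.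
Qed.

Lemma circulant_sum (v : 'cV_d.+1) : \sum_m P m *m v = v.
Proof.
have [_ _ /(_ 0)[_ sum1]] := @pol_gen_magic C n.+1.
rewrite -mulmx_suml -[RHS]mul1mx -[1%:M](rmorph1 rho) -sum1 raddf_sum.
by congr (_ *m v); apply: eq_bigr => m _; rewrite -rho_first_col.
Qed.

Lemma circulant_sumN (v : 'cV_d.+1) : \sum_m P (- m) *m v = v.
Proof. by rewrite -[RHS]circulant_sum [RHS](reindex_inj oppr_inj). Qed.

Lemma inner_circulant m u v : inner (P m *m u) v = inner u (P m *m v).
Proof. by rewrite inner_mulmxl circulant_self_adjoint. Qed.

Lemma cocycle1 : eta 1 = 0.
Proof.
have := etaM 1 1; rewrite mulr1 !rmorph1 mul1mx scale1r => /eqP.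
by rewrite -subr_eq0 opprD addNKr oppr_eq0 => /eqP.
Qed.

(** Both formulas come from the vanishing of a product of two distinct
    generators, one diagonal, in a column or in a row. *)
Lemma cocycle_offdiag j k : j != k ->
  eta (p j k) = - (P (j - k) *m xi k) /\ eta (p k j) = - (P (k - j) *m xi k).
Proof.
have [_ orth _] := @pol_gen_magic C n.+1.
move=> jk; have [row col] := orth k _ _ jk.
split; apply/eqP; rewrite -addr_eq0 addrC -rho_gen.
  by have := etaM (p j k) (p k k); rewrite col raddf0 counit_gen eqxx scale1r => <-.
by have := etaM (p k j) (p k k); rewrite row raddf0 counit_gen eqxx scale1r => <-.
Qed.

(** A submodule, in the sense of the representation [rho], of the space of pairs
    [(v, w)] on whose second component [a] acts through [twist a]. *)
Definition twisted_closed (M : 'cV[C]_d.+1 -> 'cV[C]_d.+1 -> Prop) : Prop :=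
  [/\ forall v w v' w', M v w -> M v' w' -> M (v + v') (w + w'),
      forall c v w, M v w -> M (c *: v) (c^* *: w)
    & forall m v w, M v w -> M (P m *m v) (P (- m) *m w)].

(** Left multiplication by any [a] preserves the set of [b] with
    [M (eta b) (eta (twist b))]: by the cocycle identity it suffices to have [a]
    a generator and [M] containing the values at the generators, which the
    previous lemma reduces to the diagonal ones. *)
Lemma twisted_closed_cocycle M b :
  twisted_closed M -> (forall j, M (xi j) (xi j)) ->
  M (eta b) (eta (twist b)).
Proof.
move=> [MD MZ MP] Mxi.
have Mgen j k : M (eta (p j k)) (eta (p k j)).
  have [->//|jk] := eqVneq j k.
  have [-> ->] := cocycle_offdiag _ _ jk.
  rewrite -!scaleN1r -[X in M _ (X *: _)](_ : (-1)^* = -1 :> C).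
    by apply: MZ; rewrite -[k - j]opprB; apply: MP.
  by rewrite rmorphN rmorph1.
have M0 : M 0 0 by have := MZ 0 _ _ (Mxi 0); rewrite conjC0 !scale0r.
suff mul_stable a : forall x, M (eta x) (eta (twist x)) ->
    M (eta (a * x)) (eta (twist (a * x))).
  by rewrite -[b]mulr1; apply: mul_stable; rewrite twist1 cocycle1.
elim/(@pol_ind C n.+1): a => [j k|c|a1 a2 IH1 IH2|a1 a2 IH1 IH2] x Mx.
- rewrite twistM twist_gen !etaM counit_twist !rho_gen.
  by apply: MD; [rewrite -[k - j]opprB; apply: MP|apply: MZ].
- by rewrite mulr_algl twistZ !linearZ; apply: MZ.
- by rewrite mulrDl twistD !raddfD; apply: MD; [apply: IH1|apply: IH2].
- by rewrite -mulrA; apply/IH1/IH2.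
Qed.

(** * Symmetry of the generating functional *)

Definition circulant_symmetric : Prop := forall i m k,
  inner (xi i) (P m *m xi k) = inner (P (- m) *m xi k) (xi i).

(** The orthogonal of the pairs [(P_m xi_i, P_(- m) xi_i)] for the form
    [<x, v> - <w, y>] on pairs [(x, y)] and [(v, w)]. *)
Definition twisted_annihilator (v w : 'cV[C]_d.+1) : Prop :=
  forall i m, inner (xi i) (P m *m v) = inner (P (- m) *m w) (xi i).

Definition twisted_biannihilator (v w : 'cV[C]_d.+1) : Prop :=
  forall v' w', twisted_annihilator v' w' -> inner v v' = inner w' w.

Lemma twisted_annihilator_closed : twisted_closed twisted_annihilator.
Proof.
split.
- move=> v w v' w' vw vw' i m.
  by rewrite !mulmxDr innerDr innerDl vw vw'.
- move=> c v w vw i m.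
  by rewrite -!scalemxAr innerZr innerZl conjCK vw.
- move=> k v w vw i m.
  rewrite !mulmxA !circulant_mul eqr_opp -!scalemxAl innerZr innerZl conjC_nat.
  by rewrite vw.
Qed.

Lemma twisted_biannihilator_closed : twisted_closed twisted_biannihilator.
Proof.
have [_ _ annP] := twisted_annihilator_closed.
split.
- by move=> v w v' w' vw vw' x y xy; rewrite innerDl innerDr (vw x y)// (vw' x y).
- by move=> c v w vw x y xy; rewrite innerZl innerZr (vw x y).
- move=> m v w vw x y xy.
  by rewrite inner_circulant -[RHS]inner_circulant; apply/vw/annP.
Qed.

Lemma circulant_symmetric_annihilator b :
  circulant_symmetric -> twisted_annihilator (eta b) (eta (twist b)).
Proof.
move=> sym; apply: twisted_closed_cocycle twisted_annihilator_closed _.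
by move=> k i m; apply: sym.
Qed.

(** The pairs [(eta b, eta (twist b))] lie in the annihilator, so the pairs
    [(eta a, eta (twist a))] only have to lie in the biannihilator. The pairs
    [(xi_i, xi_i)] do because the [P_m] sum to the identity. *)
Lemma inner_cocycle_twist a b : circulant_symmetric ->
  inner (eta a) (eta b) = inner (eta (twist b)) (eta (twist a)).
Proof.
move=> sym; apply: (_ : twisted_biannihilator _ _) (circulant_symmetric_annihilator _ sym).
apply: twisted_closed_cocycle twisted_biannihilator_closed _ => i v w vw.
rewrite -[v]circulant_sum -[w]circulant_sumN inner_sumr inner_suml.
by apply: eq_bigr => m _; apply: vw.
Qed.

Lemma functionalM a b : L (a * b) =
  inner (eta (star a)) (eta b) + counit a * L b + L a * counit b.
Proof. by have := schurmann_coboundary triple (star a) b; rewrite starK. Qed.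

Lemma functional_offdiag j k : j != k ->
  L (p j k) = inner (eta (p j k)) (eta (p j k)).
Proof.
move=> jk; have [/(_ j k)[gen_star gen_idem] _ _] := @pol_gen_magic C n.+1.
have := functionalM (p j k) (p j k).
by rewrite gen_idem gen_star !counit_gen (negPf jk) mul0r mulr0 !addr0.
Qed.

(** The terms with the counit are those of [functionalM] with [L] replaced by
    [L \o antipode]: when [L] is symmetric only the inner products remain to be
    compared. *)
Lemma functional_antipodeM a b : L (antipode (a * b)) =
  inner (eta (twist b)) (eta (twist (star a)))
  + counit a * L (antipode b) + L (antipode a) * counit b.
Proof.
rewrite antipodeM functionalM !counit_antipode twist_star.
by rewrite addrAC [counit b * _]mulrC [_ * counit a]mulrC.
Qed.

Lemma circulant_symmetric_functional :
  circulant_symmetric -> symmetric_functional L.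
Proof.
move=> sym; elim/(@pol_ind C n.+1) => [j k|c|a b IHa IHb|a b IHa IHb].
- rewrite antipode_gen; have [->//|jk] := eqVneq j k.
  have kj : k != j by rewrite eq_sym.
  rewrite !functional_offdiag//.
  by rewrite inner_cocycle_twist// !twist_gen.
- by rewrite linearZ /= antipode1.
- by rewrite !raddfD /= IHa IHb.
- by rewrite functional_antipodeM functionalM IHa IHb -inner_cocycle_twist.
Qed.

Lemma symmetric_functional_inner a b : symmetric_functional L ->
  inner (eta (star a)) (eta b) = inner (eta (twist b)) (eta (twist (star a))).
Proof.
move=> sym; have := sym (a * b).
by rewrite functional_antipodeM functionalM !sym => /addIr/addIr.
Qed.

Lemma symmetric_functional_circulant :
  symmetric_functional L -> circulant_symmetric.
Proof.
move=> sym i m k.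
have [/(_ i i)[gen_star _] _ _] := @pol_gen_magic C n.+1.
have inner_xi b : inner (xi i) (eta b) = inner (eta (twist b)) (xi i).
  by have := symmetric_functional_inner (p i i) b sym; rewrite gen_star twist_gen.
(* The identity for [p m 0] alone cancels the terms added by the cocycle rule. *)
have := inner_xi (p m 0 * p k k).
rewrite twistM !twist_gen !etaM !counit_gen eqxx !scale1r innerDr innerDl.
by rewrite rho_first_col rho_first_row inner_xi twist_gen => /addIr.
Qed.

End Circulant.

Theorem proposition10p3 (R : realType) (n : nat)
    (eta : {linear pol R[i] n.+1 -> 'cV[R[i]]_n.+1})
    (L : {scalar pol R[i] n.+1})
    (hL : schurmann_triple (fourier_rep R n) eta L) :
  let xi (j : 'I_n.+1) := eta (pol_gen j j) in
  symmetric_functional L <->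
  (forall i m k : 'I_n.+1,
     inner (xi i) (fourier_proj m *m xi k)
     = inner (fourier_proj (- m) *m xi k) (xi i)).
Proof.
move=> xi; split.
  exact: (symmetric_functional_circulant hL fourier_rep_gen).
exact: (circulant_symmetric_functional hL fourier_rep_gen).
Qed.
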